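(* Let $P=p_0+p_1\mathbf{e}_i+p_2\mathbf{e}_j+p_3\mathbf{e}_k$ and $Q=q_0+q_1\mathbf{e}_i+q_2\mathbf{e}_j+q_3\mathbf{e}_k$ be elements of $\mathcal{Q}$, with all $p_\ell,q_\ell\in\mathbb{R}$. Then $$P\wedge_{\mathcal{Q}}Q=\alpha+\beta\,\mathbf{e}_i+\gamma\,\mathbf{e}_j+\delta\,\mathbf{e}_k,$$ where $$\alpha=p_0q_0-p_1q_1-p_2q_2-p_3q_3,\qquad \beta=p_0q_1+q_0p_1+p_2q_3-p_3q_2,$$ $$\gamma=p_0q_2+q_0p_2+q_1p_3-p_1q_3,\qquad \delta=p_0q_3+q_0p_3+p_1q_2-q_1p_2,$$ i.e. $\wedge_{\mathcal{Q}}$ coincides with the standard Hamilton product of quaternions.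
   Context: Let $V$ be the real three-dimensional space with basis $\mathbf{e}_i,\mathbf{e}_j,\mathbf{e}_k$ (labels ordered $i<j<k$), all three time-like: the dot product is the bilinear form with $\mathbf{e}_p\cdot\mathbf{e}_q=\Delta_{pq}$, where $\Delta_{ii}=\Delta_{jj}=\Delta_{kk}=-1$ and $\Delta_{pq}=0$ for $p\neq q$. Let $\mathcal{Q}$ be the real vector space of all objects $Q=a+b\,\mathbf{e}_i+c\,\mathbf{e}_j+d\,\mathbf{e}_k$ with $a,b,c,d\in\mathbb{R}$ (a scalar part $a$ plus a vector part in $V$). The vector product $\wedge_{\mathrm{vec}}$ is the bilinear product on $V$ with $\mathbf{e}_p\wedge_{\mathrm{vec}}\mathbf{e}_q=\sigma(pq,r)\,\mathbf{e}_r$ when $\{p,q,r\}=\{i,j,k\}$, where $\sigma(pq,r)$ is the sign of the permutation sorting $(p,q,r)$ into $(i,j,k)$, and $\mathbf{e}_p\wedge_{\mathrm{vec}}\mathbf{e}_p=0$. The product on $\mathcal{Q}$ is $Q_1\wedge_{\mathcal{Q}}Q_2=Q_1\cdot Q_2+Q_1\wedge_{\mathrm{vec}}Q_2$, the first term being the scalar part and the second the vector part. Explicitly, for $P=p_0+\mathbf{p}$ and $Q=q_0+\mathbf{q}$ with $p_0,q_0\in\mathbb{R}$, $\mathbf{p},\mathbf{q}\in V$: the scalar part is $P\cdot Q=p_0q_0+\mathbf{p}\cdot\mathbf{q}$ (scalars and vectors being orthogonal) and the vector part is $P\wedge_{\mathrm{vec}}Q=q_0\mathbf{p}+p_0\mathbf{q}+\mathbf{p}\wedge_{\mathrm{vec}}\mathbf{q}$.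 *)

(* Defs.v *)
From mathcomp Require Import all_boot all_order all_fingroup all_algebra.
From mathcomp Require Import reals.

Set Implicit Arguments.
Unset Strict Implicit.
Unset Printing Implicit Defensive.

Import GRing.Theory.
Local Open Scope ring_scope.

(* The ordered labels i < j < k, as the elements 0 < 1 < 2 of 'I_3. *)
Definition li : 'I_3 := @Ordinal 3 0 isT.
Definition lj : 'I_3 := @Ordinal 3 1 isT.
Definition lk : 'I_3 := @Ordinal 3 2 isT.

Definition basis (R : realType) (p : 'I_3) : 'rV[R]_3 := delta_mx 0 p.

Definition Delta (R : realType) (p q : 'I_3) : R := if p == q then -1 else 0.

Definition vdot (R : realType) (u v : 'rV[R]_3) : R :=
  \sum_(p < 3) \sum_(q < 3) u 0 p * v 0 q * Delta R p q.

(* The sum has one term, the permutation taking (i, j, k) to (p, q, r), when   *)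
(* {p, q, r} = {i, j, k}, and is empty otherwise; a permutation and its        *)
(* inverse, which sorts (p, q, r) into (i, j, k), have the same sign.          *)
Definition sigma (R : realType) (p q r : 'I_3) : R :=
  \sum_(s : 'S_3 | [&& s li == p, s lj == q & s lk == r]) (-1) ^+ s.

(* For p != q only the third label r contributes; for p = q the sum is 0. *)
Definition basis_wedge (R : realType) (p q : 'I_3) : 'rV[R]_3 :=
  \sum_(r < 3) sigma R p q r *: basis R r.

Definition vwedge (R : realType) (u v : 'rV[R]_3) : 'rV[R]_3 :=
  \sum_(p < 3) \sum_(q < 3) (u 0 p * v 0 q) *: basis_wedge R p q.

(* Pairs (scalar part, vector part), with the product vector space structure;  *)
(* R^o is R seen as a vector space over itself.                                *)
Definition quat (R : realType) : lmodType R := (R^o * 'rV[R]_3)%type.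

Definition mkquat (R : realType) (a b c d : R) : quat R :=
  (a, b *: basis R li + c *: basis R lj + d *: basis R lk).

Definition qdot (R : realType) (P Q : quat R) : R :=
  P.1 * Q.1 + vdot P.2 Q.2.

Definition qwedge_vec (R : realType) (P Q : quat R) : 'rV[R]_3 :=
  Q.1 *: P.2 + P.1 *: Q.2 + vwedge P.2 Q.2.

Definition qwedge (R : realType) (P Q : quat R) : quat R :=
  (qdot P Q, qwedge_vec P Q).

(* Hamilton's product with respect to the basis 1, e_i, e_j, e_k: bilinear,    *)
(* with unit 1, and given on the imaginary units by Hamilton's table.          *)
Definition hamilton_product (R : realType) (mul : quat R -> quat R -> quat R) :
    Prop :=
  let one := mkquat 1 0 0 0 in
  let I := mkquat 0 1 0 0 in
  let J := mkquat 0 0 1 0 in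
  let K := mkquat 0 0 0 1 in
  [/\ (forall P, linear (mul P)) /\ (forall Q, linear (mul^~ Q)),
      (forall P, mul one P = P) /\ (forall P, mul P one = P),
      [/\ mul I I = - one, mul J J = - one & mul K K = - one],
      [/\ mul I J = K, mul J K = I & mul K I = J] &
      [/\ mul J I = - K, mul K J = - I & mul I K = - J]].

(* Main.v *)
(** The value of [sigma p q r] is the sign of the unique permutation with images
    [p], [q], [r], so [vwedge] is the usual cross product in coordinates and the
    formula for [qwedge] is an expansion.  Bilinearity and the table of the
    imaginary units force the same formula on any Hamilton product, which gives
    uniqueness. *)

Require Import Defs.
From mathcomp Require Import all_boot all_order all_fingroup all_algebra.
From mathcomp Require Import reals.
From mathcomp Require Import boolp ring.

Import GRing.Theory.
Local Open Scope ring_scope.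

Lemma ord3P (p : 'I_3) : [\/ p = li, p = lj | p = lk].
Proof.
by case: p => [[|[|[|n]]] ltn3] //;
  [apply: Or31 | apply: Or32 | apply: Or33]; apply: val_inj.
Qed.

Lemma sum_ord3 (V : zmodType) (F : 'I_3 -> V) :
  \sum_(p < 3) F p = F li + F lj + F lk.
Proof.
rewrite !big_ord_recr big_ord0 /= add0r.
by congr (F _ + F _ + F _); apply: val_inj.
Qed.

(** A permutation of three labels is determined by its three images, so [s] indexes the only term of
    the sum defining [sigma]. *)
Lemma sigma_perm (R : realType) (s : 'S_3) (p q r : 'I_3) :
  s li = p -> s lj = q -> s lk = r -> sigma R p q r = (-1) ^+ s.
Proof.
move=> <- <- <-; rewrite /sigma (big_pred1 s) // => t /=.
apply/and3P/eqP => [[/eqP ti /eqP tj /eqP tk]|-> //].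
by apply/permP => x; case: (ord3P x) => ->.
Qed.

(** Permutations are injective, so a repeated label leaves the sum empty. *)
Lemma sigma_eq0 (R : realType) (p q r : 'I_3) :
  [|| p == q, q == r | p == r] -> sigma R p q r = 0.
Proof.
move=> pqr; rewrite /sigma big_pred0 // => s.
apply/negP => /and3P[/eqP sp /eqP sq /eqP sr].
by move: pqr; rewrite -sp -sq -sr !(inj_eq perm_inj).
Qed.

Lemma sigma_even (R : realType) :
  [/\ sigma R li lj lk = 1, sigma R lj lk li = 1 & sigma R lk li lj = 1].
Proof.
split.
- by rewrite (@sigma_perm R 1%g) ?perm1 // odd_perm1.
(* In a product of permutations the left factor acts first; the two 3-cycles are even as products of
   two transpositions. *)
- by rewrite (@sigma_perm R (tperm li lj * tperm li lk)%g) ?permM ?permE //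
    odd_permM !odd_tperm.
- by rewrite (@sigma_perm R (tperm li lk * tperm li lj)%g) ?permM ?permE //
    odd_permM !odd_tperm.
Qed.

Lemma sigma_odd (R : realType) :
  [/\ sigma R lj li lk = -1, sigma R lk lj li = -1 & sigma R li lk lj = -1].
Proof.
split.
- by rewrite (@sigma_perm R (tperm li lj)) ?permE // odd_tperm.
- by rewrite (@sigma_perm R (tperm li lk)) ?permE // odd_tperm.
- by rewrite (@sigma_perm R (tperm lj lk)) ?permE // odd_tperm.
Qed.

Lemma basis_wedgeE (R : realType) (p q r : 'I_3) :
  basis_wedge R p q 0 r = sigma R p q r.
Proof.
rewrite /basis_wedge summxE (bigD1 r) //= !mxE !eqxx mulr1.
by rewrite big1 ?addr0 // => s /negPf sr; rewrite !mxE eq_sym sr mulr0.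
Qed.

Lemma vwedgeE (R : realType) (u v : 'rV[R]_3) (r : 'I_3) :
  vwedge u v 0 r = \sum_(p < 3) \sum_(q < 3) u 0 p * v 0 q * sigma R p q r.
Proof.
rewrite /vwedge summxE; apply: eq_bigr => p _.
by rewrite summxE; apply: eq_bigr => q _; rewrite mxE basis_wedgeE.
Qed.

(** Of the nine terms of each coordinate, seven have a repeated label and vanish; the other two
    carry opposite signs. *)
Lemma vwedge_coord (R : realType) (u v : 'rV[R]_3) :
  [/\ vwedge u v 0 li = u 0 lj * v 0 lk - u 0 lk * v 0 lj,
      vwedge u v 0 lj = u 0 lk * v 0 li - u 0 li * v 0 lk
    & vwedge u v 0 lk = u 0 li * v 0 lj - u 0 lj * v 0 li].
Proof.
have [e1 e2 e3] := sigma_even R; have [o1 o2 o3] := sigma_odd R.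
by split; rewrite vwedgeE !sum_ord3 ?e1 ?e2 ?e3 ?o1 ?o2 ?o3 !sigma_eq0 //; ring.
Qed.

Lemma vdotE (R : realType) (u v : 'rV[R]_3) :
  vdot u v = - (u 0 li * v 0 li) - u 0 lj * v 0 lj - u 0 lk * v 0 lk.
Proof. by rewrite /vdot !sum_ord3 /Delta /=; ring. Qed.

Lemma mkquat_coord (R : realType) (a b c d : R) :
  [/\ (mkquat a b c d).2 0 li = b, (mkquat a b c d).2 0 lj = c
    & (mkquat a b c d).2 0 lk = d].
Proof. by split; rewrite !mxE /=; ring. Qed.

Lemma quatE (R : realType) (P : quat R) :
  P = mkquat (P.1 : R) (P.2 0 li) (P.2 0 lj) (P.2 0 lk).
Proof.
case: P => a u; congr pair; apply/rowP => r /=.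
have [ri rj rk] := mkquat_coord R a (u 0 li) (u 0 lj) (u 0 lk).
by case: (ord3P r) => ->; rewrite ?ri ?rj ?rk.
Qed.

(** The left side has the shape [x *: u + v] used by [linear], so linear combinations collapse to a
    single [mkquat]. *)
Lemma mkquat_linear (R : realType) (x a b c d a' b' c' d' : R) :
  x *: mkquat a b c d + mkquat a' b' c' d'
    = mkquat (x * a + a') (x * b + b') (x * c + c') (x * d + d').
Proof.
congr pair; rewrite /= !scalerDr !scalerA !scalerDl.
by rewrite addrACA; congr (_ + _); rewrite addrACA.
Qed.

Lemma mkquatN (R : realType) (a b c d : R) :
  - mkquat a b c d = mkquat (- a) (- b) (- c) (- d).
Proof. by congr pair; rewrite /= !opprD !scaleNr. Qed.

Lemma qwedge_mkquat (R : realType) (p0 p1 p2 p3 q0 q1 q2 q3 : R) :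
  qwedge (mkquat p0 p1 p2 p3) (mkquat q0 q1 q2 q3)
    = mkquat (p0 * q0 - p1 * q1 - p2 * q2 - p3 * q3)
             (p0 * q1 + q0 * p1 + p2 * q3 - p3 * q2)
             (p0 * q2 + q0 * p2 + q1 * p3 - p1 * q3)
             (p0 * q3 + q0 * p3 + p1 * q2 - q1 * p2).
Proof.
have [pi pj pk] := mkquat_coord R p0 p1 p2 p3.
have [qi qj qk] := mkquat_coord R q0 q1 q2 q3.
rewrite [LHS]quatE /qwedge /qdot /qwedge_vec vdotE.
set u := (mkquat p0 p1 p2 p3).2 in pi pj pk *.
set v := (mkquat q0 q1 q2 q3).2 in qi qj qk *.
have [wi wj wk] := vwedge_coord R u v.
by rewrite [LHS]/=; congr mkquat;
  rewrite ?mxE ?wi ?wj ?wk ?pi ?pj ?pk ?qi ?qj ?qk /=; ring.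
Qed.

Lemma hamilton_product_mkquat (R : realType) (mul : quat R -> quat R -> quat R)
    (p0 p1 p2 p3 q0 q1 q2 q3 : R) :
  hamilton_product mul ->
  mul (mkquat p0 p1 p2 p3) (mkquat q0 q1 q2 q3)
    = mkquat (p0 * q0 - p1 * q1 - p2 * q2 - p3 * q3)
             (p0 * q1 + q0 * p1 + p2 * q3 - p3 * q2)
             (p0 * q2 + q0 * p2 + q1 * p3 - p1 * q3)
             (p0 * q3 + q0 * p3 + p1 * q2 - q1 * p2).
Proof.
case=> [[linr linl] [mul1q mulq1] [II JJ KK] [IJ JK KI] [JI KJ IK]].
(* Linearity at scalar -1 and two zero vectors reads [mul P 0 = - mul P 0 + mul P 0]. *)
have mulr0 P : mul P 0 = 0.
  by have := linr P (-1) 0 0; rewrite !scaleN1r oppr0 addr0 addNr.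
have mul0r P : mul 0 P = 0.
  by have := linl P (-1) 0 0; rewrite !scaleN1r oppr0 addr0 addNr.
have mk0 : mkquat 0 0 0 0 = 0 :> quat R.
  by congr pair; rewrite /= !scale0r !addr0.
(* Nesting to the right with a final 0 gives every stage the shape [x *: u + v], to which [linl] and
   [linr] apply directly. *)
have decomp a b c d : mkquat a b c d = a *: mkquat 1 0 0 0
    + (b *: mkquat 0 1 0 0 + (c *: mkquat 0 0 1 0 + (d *: mkquat 0 0 0 1 + 0)))
    :> quat R.
  by rewrite -mk0 !mkquat_linear; congr mkquat; ring.
rewrite (decomp p0 p1 p2 p3) !linl mul0r (decomp q0 q1 q2 q3) !linr !mulr0.
(* The sixteen products of basis elements are read off the unit laws and the table; turning 0 back
   into a [mkquat] lets the nested sums be collected. *)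
rewrite !mul1q !mulq1 II JJ KK IJ JK KI JI KJ IK -mk0 !mkquatN !mkquat_linear.
by congr mkquat; ring.
Qed.

(** With all arguments in [mkquat] form, each clause becomes four polynomial identities over [R]. *)
Lemma qwedge_hamilton (R : realType) : hamilton_product (@qwedge R).
Proof.
split.
- split=> P x Q S; rewrite (quatE R P) (quatE R Q) (quatE R S);
    rewrite !(mkquat_linear, qwedge_mkquat); congr mkquat; ring.
- by split=> P; rewrite (quatE R P) qwedge_mkquat; congr mkquat; ring.
all: by split; rewrite qwedge_mkquat ?mkquatN; congr mkquat; ring.
Qed.

Theorem mainTheorem2 (R : realType) :
  (forall p0 p1 p2 p3 q0 q1 q2 q3 : R,
    let alpha := p0 * q0 - p1 * q1 - p2 * q2 - p3 * q3 in
    let beta := p0 * q1 + q0 * p1 + p2 * q3 - p3 * q2 in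
    let gamma := p0 * q2 + q0 * p2 + q1 * p3 - p1 * q3 in
    let delta := p0 * q3 + q0 * p3 + p1 * q2 - q1 * p2 in
    qwedge (mkquat p0 p1 p2 p3) (mkquat q0 q1 q2 q3)
      = mkquat alpha beta gamma delta)
  /\ (forall mul : quat R -> quat R -> quat R,
        hamilton_product mul <-> (forall P Q : quat R, mul P Q = qwedge P Q)).
Proof.
split=> [*|mul]; first exact: qwedge_mkquat.
split=> [hmul P Q|mulE].
  by rewrite (quatE R P) (quatE R Q) hamilton_product_mkquat // qwedge_mkquat.
(* Function extensionality turns the pointwise equality into one along which [hamilton_product] can
   be transported. *)
have -> : mul = @qwedge R by apply/funext => P; apply/funext => Q.
exact: qwedge_hamilton.
Qed.
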